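(* The higher weight spectra of the Veronese code $C_2$ over $\mathbb{F}_2$ are \[ \begin{array}{llll} A_{2}^{(1)}=21, & A_{4}^{(1)}=35, & A_{6}^{(1)}=7, & A_{3}^{(2)}=35,\\ A_{4}^{(2)}=105, & A_{4}^{(3)}=35, & A_{5}^{(2)}=210, & A_{5}^{(3)}=210,\\ A_{5}^{(4)}=21, & A_{6}^{(2)}=210, & A_{6}^{(3)}=560, & A_{6}^{(4)}=175,\\ A_{6}^{(5)}=7, & A_{7}^{(2)}=91, & A_{7}^{(3)}=590, & A_{7}^{(4)}=455,\\ A_{7}^{(5)}=56, & A_{7}^{(6)}=1, & & \end{array} \] and all other $A_w^{(r)}$ are $0$.
   Context: For a prime power $q$, fix an ordering of the $q^2+q+1$ points of $\mathbb{P}^2$ over $\mathbb{F}_q$ and a coordinate representative $(x,y,z)$ of each. The Veronese code $C_q$ is the linear $[q^2+q+1,6]_q$ code with generator matrix whose columns are the vectors $(x^2,xy,xz,y^2,yz,z^2)$ for the chosen representatives; here $q=2$, giving a $[7,6]_2$ code. For a subcode $D$, its weight is the number of coordinates $i$ such that some codeword of $D$ has nonzero $i$-th entry. $A_w^{(r)}$ is the number of subcodes of dimension $r$ and weight $w$. *)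

(* Defs.v *)
From HB Require Import structures.
From mathcomp Require Import all_boot all_order all_algebra.

Set Implicit Arguments.
Unset Strict Implicit.
Unset Printing Implicit Defensive.

Import GRing.Theory.
Local Open Scope ring_scope.

(* A subspace is represented by its canonical generating matrix, so over a
   finite field there are finitely many of them and they can be counted. *)
Section FiniteVspace.

Import VectorInternalTheory.

Variables (F : finFieldType) (vT : vectType F).

HB.instance Definition _ := [Countable of {vspace vT} by <:].
HB.instance Definition _ := [Finite of {vspace vT} by <:].

End FiniteVspace.

Section Codes.

Variables (F : finFieldType) (n : nat).

Definition support (D : {vspace 'rV[F]_n}) : {set 'I_n} :=
  [set i | [exists v : 'rV[F]_n, (v \in D) && (v 0 i != 0)]].

Definition weight (D : {vspace 'rV[F]_n}) : nat := #|support D|.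

Definition code_of m (G : 'M[F]_(m, n)) : {vspace 'rV[F]_n} :=
  <<[seq row k G | k : 'I_m]>>%VS.

(* A_w^(r) *)
Definition higher_weight (C : {vspace 'rV[F]_n}) (r w : nat) : nat :=
  #|[set D : {vspace 'rV[F]_n} |
      [&& (D <= C)%VS, \dim D == r & weight D == w]]|.

End Codes.

Section Veronese.

Variables (F : finFieldType) (n : nat).

(* The points of the projective plane over F are the lines of F^3; P lists
   each of them exactly once, through a nonzero coordinate representative. *)
Definition plane_representatives (P : 'I_n -> 'rV[F]_3) : Prop :=
  (forall i, P i != 0) /\
  (forall L : {vspace 'rV[F]_3}, \dim L = 1%N ->
     exists! i, <[P i]>%VS = L).

Definition veronese_vector (p : 'rV[F]_3) : 'cV[F]_6 :=
  let x := p 0 (inord 0) in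
  let y := p 0 (inord 1) in
  let z := p 0 (inord 2) in
  \col_(k < 6) [:: x ^+ 2; x * y; x * z; y ^+ 2; y * z; z ^+ 2]`_k.

Definition veronese_generator (P : 'I_n -> 'rV[F]_3) : 'M[F]_(6, n) :=
  \matrix_(k < 6, i < n) veronese_vector (P i) k 0.

Definition veronese_code (P : 'I_n -> 'rV[F]_3) : {vspace 'rV[F]_n} :=
  code_of (veronese_generator P).

End Veronese.

(* Main.v *)
(* The rows of the generator matrix have even weight and a quadratic form over
   F_2 vanishing at all points of the plane is zero, so C_2 is the even weight
   code of length 7 and its subcode supported in a set S has dimension
   max(0, #|S| - 1).  Counting the pairs (D, S) with #|S| = s, where D is an
   r-dimensional subcode supported in S, in two ways gives
     \sum_w A_w^(r) 'C(7 - w, 7 - s) = 'C(7, s) * qbinom 2 (s - 1) r,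
   a system that is triangular in w and determines all the A_w^(r). *)
Require Import Defs.
From mathcomp Require Import all_boot all_order all_algebra all_field.
From mathcomp Require Import zify.
Import GRing.Theory.

(** * Frames and Gaussian binomials *)

(** The number of ordered independent [r]-tuples in dimension [d] over a field of [q] elements; for
    [r > d] the factor [i = d] makes it 0. *)
Definition frames (q d r : nat) : nat := \prod_(i < r) (q ^ d - q ^ i).

(** The Gaussian binomial coefficient, by the [q]-Pascal rule. *)
Fixpoint qbinom (q d r : nat) : nat :=
  match d, r with
  | _, 0 => 1
  | 0, _.+1 => 0
  | d'.+1, r'.+1 => qbinom q d' r' + q ^ r * qbinom q d' r
  end.

Lemma framesSS q d r :
  frames q d.+1 r.+1 = (q ^ d.+1 - 1) * q ^ r * frames q d r.
Proof.
rewrite /frames big_ord_recl expn0 -mulnA; congr (_ * _).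
rewrite (eq_bigr (fun i : 'I_r => q * (q ^ d - q ^ i))) => [|i _].
  by rewrite big_split /= prod_nat_const card_ord.
by rewrite mulnBr -!expnS.
Qed.

Lemma frames_eq0 q d r : d < r -> frames q d r = 0.
Proof. by move=> lt_dr; rewrite /frames (bigD1 (Ordinal lt_dr)) //= subnn. Qed.

Lemma frames_gt0 q r : 1 < q -> 0 < frames q r r.
Proof.
move=> q_gt1; apply: prodn_gt0 => i.
by rewrite subn_gt0 ltn_exp2l.
Qed.

Lemma frames_qbinom q d r :
  0 < q -> frames q d r = qbinom q d r * frames q r r.
Proof.
move=> q_gt0; elim: d r => [|d IHd] [|r] //=.
- by rewrite /frames !big_ord0.
- by rewrite frames_eq0.
- by rewrite /frames !big_ord0.
rewrite mulnDl -[_ * _ * frames _ _ _]mulnA -IHd !framesSS.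
rewrite [qbinom q d r * _]mulnCA -IHd.
rewrite {3}/frames big_ord_recr /= -/(frames q d r).
have [lt_dr | le_rd] := ltnP d r; first by rewrite frames_eq0 // !muln0.
(* The first summand yields the [qbinom q d r] term; the second, times [q ^ r], is [q ^ r.+1] times
   the last factor [q ^ d - q ^ r] of [frames q d r.+1]. *)
have -> : q ^ d.+1 - 1 = (q ^ r.+1 - 1) + (q ^ d.+1 - q ^ r.+1).
  have := leq_pexp2l q_gt0 (leqW le_rd : r <= d.+1).
  have : q ^ r.+1 <= q ^ d.+1 by rewrite leq_pexp2l.
  have : 0 < q ^ r.+1 by rewrite expn_gt0 q_gt0.
  lia.
rewrite !expnS -mulnBr; nia.
Qed.

(** * Counting subspaces over a finite field *)

Section Subspaces.

Variables (F : finFieldType) (n : nat).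
Implicit Types (U D : {vspace 'rV[F]_n}) (S : {set 'I_n}).

Lemma card_memv U : #|[set v in U]| = #|F| ^ \dim U.
Proof. by rewrite cardsE (card_vspace U). Qed.

(** A free [r]-tuple in [U] extends by any vector of [U] outside its span, which leaves
    [#|F| ^ \dim U - #|F| ^ r] choices. *)
Lemma card_free_tuples U r :
  #|[set X : r.-tuple 'rV[F]_n | free X && (<<X>> <= U)%VS]|
    = frames #|F| (\dim U) r.
Proof.
elim: r => [|r IHr].
  rewrite /frames big_ord0; apply/eqP/cards1P; exists [tuple].
  by apply/setP=> X; rewrite !inE tuple0 nil_free span_nil sub0v eqxx.
rewrite -sum1dep_card.
rewrite (reindex (fun p : r.-tuple 'rV[F]_n * 'rV[F]_n =>
  [tuple of p.2 :: p.1])) /=; last first.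
  exists (fun X : r.+1.-tuple _ => ([tuple of behead X], thead X)) => [[Y v]|X] _ /=.
    by congr (_, _); apply: val_inj.
  by rewrite -tuple_eta.
rewrite (eq_bigl (fun p : r.-tuple 'rV[F]_n * 'rV[F]_n =>
  (p.1 \in [set X : r.-tuple 'rV[F]_n | free X && (<<X>> <= U)%VS])
   && ((p.2 \in U) && (p.2 \notin <<p.1>>%VS)))); last first.
  move=> [Y v] /=; rewrite inE free_cons span_cons subv_add -memvE.
  by rewrite -!andbA; do !bool_congr.
rewrite -(pair_big_dep _ (fun (Y : r.-tuple 'rV[F]_n) v =>
  (v \in U) && (v \notin <<Y>>%VS)) (fun _ _ => 1)) /=.
rewrite (eq_bigr (fun=> #|F| ^ \dim U - #|F| ^ r)) => [|Y]; last first.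
  rewrite -[X in is_true X -> _]/(Y \in [set _ | _]) inE.
  move=> /andP[/eqP freeY sYU].
  rewrite size_tuple in freeY.
  have sYU' : [set v in <<Y>>%VS] \subset [set v in U].
    by apply/subsetP=> v; rewrite !inE; apply: (subvP sYU).
  rewrite sum1dep_card -[in RHS]freeY -!card_memv -(cardsDS sYU').
  by apply: eq_card => v; rewrite !inE andbC.
by rewrite sum_nat_const IHr /frames big_ord_recr.
Qed.

(** Group the free [r]-tuples of [U] by their span: each subspace of dimension [r] arises from
    [frames #|F| r r] of them, a positive number that cancels. *)
Lemma card_subspaces U r :
  #|[set D | (D <= U)%VS & \dim D == r]| = qbinom #|F| (\dim U) r.
Proof.
have F_gt1 : 1 < #|F| := finNzRing_gt1 F.
apply/eqP; rewrite -(eqn_pmul2r (frames_gt0 _ r F_gt1)); apply/eqP.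
rewrite -[RHS]frames_qbinom 1?ltnW // -[RHS]card_free_tuples -[RHS]sum1dep_card.
rewrite (partition_big (fun X : r.-tuple _ => <<X>>%VS)
          (mem [set D | (D <= U)%VS & \dim D == r])) /=; last first.
  by move=> X /andP[/eqP freeX sXU]; rewrite inE sXU freeX size_tuple eqxx.
rewrite -sum_nat_const; apply: eq_bigr => D.
rewrite inE => /andP[sDU /eqP dimD].
rewrite sum1dep_card -[X in frames _ X]dimD -[LHS]card_free_tuples.
apply: eq_card => X.
rewrite !inE; apply/andP/andP=> [[freeX sXD] | [/andP[freeX _] /eqP <-]].
  rewrite freeX (subv_trans sXD sDU); split=> //.
  by rewrite eqEdim sXD dimD (eqP freeX) size_tuple leqnn.
by split=> //; apply: subvv.
Qed.

(** * Coordinate subspaces and the double count *)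

Definition coord_space (S : {set 'I_n}) : {vspace 'rV[F]_n} :=
  <<[seq delta_mx 0%R i | i <- enum S]>>%VS.

Lemma dim_coord_space S : \dim (coord_space S) = #|S|.
Proof.
pose e (i : 'I_n) : 'rV[F]_n := delta_mx 0%R i.
have free_e : free (map e (enum 'I_n)).
  suff: basis_of fullv (map e (enum 'I_n)) by apply: basis_free.
  rewrite basisEdim size_map size_enum_ord dimvf /dim /= mul1n leqnn andbT.
  apply/subvP=> v _; rewrite (row_sum_delta v).
  by apply: rpred_sum => i _; rewrite rpredZ ?memv_span ?map_f ?mem_enum.
(* With [S] listed first, its unit vectors form an initial segment of a free family. *)
have perm_S : perm_eq (enum 'I_n) (enum S ++ enum (~: S)).
  rewrite uniq_perm ?enum_uniq // => [|i].
    rewrite cat_uniq !enum_uniq andbT /=.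
    by apply/hasPn=> i; rewrite !mem_enum inE.
  by rewrite mem_cat !mem_enum !inE orbN.
have : free (map e (enum S)).
  move: free_e; rewrite (perm_free (perm_map e perm_S)) map_cat.
  exact: catl_free.
by move/eqP->; rewrite size_map -cardE.
Qed.

Lemma coord_spaceP S (v : 'rV[F]_n) :
  reflect (forall i, v 0 i != 0 -> i \in S)%R (v \in coord_space S).
Proof.
apply: (iffP idP) => [vS i | vS].
  apply: contraNT => iS; rewrite (coord_span vS) summxE big1 // => k _.
  have ltk : k < size [seq (delta_mx 0%R i : 'rV[F]_n) | i <- enum S].
    by rewrite size_map -cardE.
  have /mapP[j jS ->] := mem_nth 0%R ltk.
  rewrite !mxE eqxx andTb [i == j]negbTE ?mulr0 //.
  by apply: contraNneq iS => ->; rewrite -mem_enum.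
rewrite (row_sum_delta v); apply: rpred_sum => i _.
have [-> | /vS iS] := eqVneq (v 0 i)%R 0%R; first by rewrite scale0r mem0v.
by rewrite rpredZ ?memv_span ?map_f ?mem_enum.
Qed.

Lemma sub_coord_space D S : (D <= coord_space S)%VS = (Defs.support D \subset S).
Proof.
apply/subvP/subsetP => [sDS i | sDS v vD].
  by rewrite inE => /existsP[v /andP[/sDS/coord_spaceP vS /vS]].
apply/coord_spaceP => i vi; apply: sDS.
by rewrite inE; apply/existsP; exists v; rewrite vD.
Qed.

(* Both sides count the pairs [(D, S)] with [D] of dimension [r] in [C] and
   [Defs.support D \subset S], [#|S| = s]. *)
Lemma higher_weight_sum (C : {vspace 'rV[F]_n}) (k : nat -> nat) r s :
    (forall S, \dim (C :&: coord_space S) = k #|S|) -> s <= n ->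
  \sum_(w < n.+1) higher_weight C r w * 'C(n - w, n - s)
    = 'C(n, s) * qbinom #|F| (k s) r.
Proof.
move=> dimC le_sn.
pose Dr := [set D | (D <= C)%VS & \dim D == r].
have sub_count D :
    \sum_(S : {set 'I_n} | (#|S| == s) && (Defs.support D \subset S)) 1
      = 'C(n - weight D, n - s).
  have -> : n - weight D = #|~: Defs.support D| by rewrite cardsCs setCK card_ord.
  (* Complementation turns the [s]-sets containing the support into the [(n - s)]-subsets of its
     complement. *)
  rewrite -cards_draws -sum1dep_card (reindex_inj (@setC_inj _)).
  apply: eq_bigl => S; rewrite [X in _ && X]subsetC andbC; congr (_ && _).
  have := cardsC S; rewrite card_ord => cardS.
  by apply/eqP/eqP; lia.
transitivity (\sum_(D in Dr) 'C(n - weight D, n - s)).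
  rewrite (partition_big (fun D => inord (weight D) : 'I_n.+1) xpredT) //=.
  apply: eq_bigr => w _; rewrite -sum_nat_const.
  have wK D : (inord (weight D) == w) = (weight D == w).
    rewrite -val_eqE /= inordK // ltnS.
    by rewrite -[n in _ <= n]card_ord max_card.
  apply: eq_big => [D | D]; first by rewrite !inE wK andbA.
  by rewrite inE => /and3P[_ _ /eqP->].
under eq_bigr do rewrite -sub_count.
rewrite (exchange_big_dep (fun S : {set 'I_n} => #|S| == s)) /=; last first.
  by move=> D S _ /andP[].
have -> : 'C(n, s) = #|[set S : {set 'I_n} | #|S| == s]|.
  by rewrite card_draws card_ord.
rewrite -sum_nat_const.
apply: eq_big => [S | S /eqP cardS]; first by rewrite inE.
rewrite sum1dep_card -cardS -dimC -card_subspaces.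
apply: eq_card => D; rewrite !inE cardS eqxx subv_cap sub_coord_space /=.
by rewrite -!andbA; do !bool_congr.
Qed.

(** * The zero-sum code, which over ['F_2] is the even weight code *)

Definition zero_sum_code : {vspace 'rV[F]_n} :=
  lker (linfun (mulmxr (const_mx 1%R : 'cV[F]_n))).

Lemma zero_sum_codeP (v : 'rV[F]_n) :
  (v \in zero_sum_code) = (\sum_i v 0 i == 0)%R.
Proof.
have sumE : (v *m const_mx 1 = (\sum_i v 0 i)%:M :> 'M_1)%R.
  apply/matrixP=> i j; rewrite !mxE !ord1 eqxx mulr1n.
  by apply: eq_bigr => k _; rewrite mxE mulr1.
rewrite memv_ker lfunE /= sumE; apply/eqP/eqP => [/matrixP/(_ 0 0)%R | ->].
  by rewrite !mxE eqxx mulr1n.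
by rewrite raddf0.
Qed.

(** Rank-nullity for the coordinate sum on [coord_space S]: it has rank 1 unless [S] is empty, and
    then [0 - 1] truncates to 0. *)
Lemma dim_zero_sum_code S : \dim (zero_sum_code :&: coord_space S) = #|S| - 1.
Proof.
rewrite capvC /zero_sum_code; set f := linfun _.
have := limg_ker_dim f (coord_space S); rewrite dim_coord_space => dimS.
have [S0 | [i iS]] := set_0Vmem S.
  by move/eqP: dimS; rewrite S0 cards0 addn_eq0 => /andP[/eqP-> _].
suff f1 : \dim (f @: coord_space S) = 1 by rewrite -dimS f1 addnK.
apply/eqP; rewrite eqn_leq; apply/andP; split.
  by rewrite (leq_trans (dimvS (subvf _))) // dimvf.
rewrite lt0n dimv_eq0; apply/eqP => fS0.
have : f (delta_mx 0 i)%R \in (f @: coord_space S)%VS.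
  by rewrite memv_img // memv_span ?map_f ?mem_enum.
rewrite fS0 memv0 -memv_ker -/zero_sum_code zero_sum_codeP.
rewrite (bigD1 i) //= big1 => [|j ji].
  by rewrite mxE !eqxx addr0 oner_eq0.
by rewrite mxE (negbTE ji) andbF.
Qed.

Lemma higher_weight_gt (C : {vspace 'rV[F]_n}) r w :
  n < w -> higher_weight C r w = 0.
Proof.
move=> lt_nw; apply: eq_card0 => D; rewrite inE;
  apply/negP => /and3P[_ _ /eqP wD].
have := max_card (Defs.support D).
by rewrite -/(weight D) wD card_ord leqNgt lt_nw.
Qed.

End Subspaces.

(** * The Veronese code over ['F_2] is the even weight code *)

Section Fano.

Local Notation n := (2 ^ 2 + 2 + 1)%N.

(** The coordinates are the binary digits of [l + 1], lowest first; the shift skips the zero vector,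
    so [l < 7] runs over all points. *)
Definition binary_point (l : nat) : 'rV['F_2]_3 :=
  \row_(j < 3) (odd (l.+1 %/ 2 ^ j))%:R%R.

(** Elements of ['F_2] are read as the naturals 0 and 1. This makes the seven points nonzero and
    distinct. *)
Lemma binary_pointK (l : 'I_n) (v := binary_point l) :
  v 0%R (inord 0) + 2 * v 0%R (inord 1) + 4 * v 0%R (inord 2) = l.+1.
Proof.
rewrite {}/v !mxE !inordK //.
by case: l => [[|[|[|[|[|[|[|//]]]]]]] ltl].
Qed.

(** The Veronese coordinates lifted to naturals, so that they can be evaluated by computation. *)
Definition binary_monomial (l k : nat) : nat :=
  let x := nat_of_bool (odd l.+1) in
  let y := nat_of_bool (odd (l.+1 %/ 2)) in
  let z := nat_of_bool (odd (l.+1 %/ 4)) in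
  nth 0 [:: x ^ 2; x * y; x * z; y ^ 2; y * z; z ^ 2] k.

Lemma veronese_binary_point l (k : 'I_6) :
  (veronese_vector (binary_point l) k 0 = (binary_monomial l k)%:R)%R.
Proof.
rewrite !mxE !inordK // /binary_monomial divn1.
by case: k => [[|[|[|[|[|[|//]]]]]] ltk] /=; rewrite ?natrX ?natrM.
Qed.

Local Ltac eval_monomials :=
  rewrite !big_ord_recr big_ord0 /=;
  repeat match goal with |- context [binary_monomial ?l ?k] =>
    let v := eval vm_compute in (binary_monomial l k) in
    change (binary_monomial l k) with v end;
  rewrite ?mulr0n ?mulr1n ?mulr0 ?mulr1 ?addr0 ?add0r.

Variable P : 'I_n -> 'rV['F_2]_3.
Hypothesis hP : plane_representatives P.

(** The only nonzero scalar is 1, so a line has a single nonzero vector and its representative is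
    forced. *)
Lemma representative_F2 (v : 'rV['F_2]_3) : (v != 0)%R -> exists i, P i = v.
Proof.
move=> v0; have [|i [Pi _]] := hP.2 <[v]>%VS; first by rewrite dim_vline v0.
exists i; have /vlineP[a Pa] : P i \in <[v]>%VS by rewrite -Pi memv_line.
have := hP.1 i; rewrite Pa; case: a {Pa} => [[|[|//]] lta].
  by rewrite (_ : Ordinal lta = 0%R) ?scale0r ?eqxx //; apply: val_inj.
by rewrite (_ : Ordinal lta = 1%R) ?scale1r //; apply: val_inj.
Qed.

Lemma binary_enumeration :
  exists2 f : 'I_n -> 'I_n, bijective f & forall l, P (f l) = binary_point l.
Proof.
have [|f Pf] := @fin_all_exists _ _ (fun (l : 'I_n) i => P i = binary_point l).
  move=> l; apply: representative_F2; apply/eqP => l0.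
  by have /= := binary_pointK l; rewrite l0 !mxE.
exists f => //; apply: injF_bij => l m eq_f.
apply: val_inj; apply: succn_inj.
by rewrite -[LHS]binary_pointK -[RHS]binary_pointK -!Pf eq_f.
Qed.

Lemma veronese_code_F2 : veronese_code P = zero_sum_code 'F_2 n.
Proof.
have [f bij_f Pf] := binary_enumeration.
have GE k l : (veronese_generator P k (f l) = (binary_monomial l k)%:R)%R.
  by rewrite mxE Pf veronese_binary_point.
apply/eqP; rewrite eqEdim; apply/andP; split.
  apply/span_subvP=> _ /imageP[k _ ->]; rewrite zero_sum_codeP.
  rewrite (reindex f) /=; last exact: onW_bij.
  under eq_bigr do rewrite mxE GE.
  rewrite -natr_sum !big_ord_recl big_ord0.
  (* A square is 1 at four of the seven points, a mixed product at two: both counts are even. *)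
  by case: k => [[|[|[|[|[|[|//]]]]]] ltk].
have -> : \dim (zero_sum_code 'F_2 n) = 6.
  have sET : (zero_sum_code 'F_2 n <= coord_space 'F_2 n [set: 'I_n])%VS.
    by rewrite sub_coord_space subsetT.
  have := dim_zero_sum_code 'F_2 n [set: 'I_n].
  by rewrite (capv_idPl sET) cardsT card_ord.
(* [g] evaluates the quadratic form with coefficients [u] at all the points; its injectivity gives
   the code dimension 6. *)
pose g := linfun (mulmxr (veronese_generator P) : 'rV_6 -> 'rV_n).
have ker_g : lker g = 0%VS.
  apply/eqP; rewrite -subv0; apply/subvP=> u; rewrite memv_ker lfunE /= memv0.
  move=> /eqP uG; pose a k := (u 0 (inord k))%R.
  have aG l : l < n -> (\sum_(k < 6) a k * (binary_monomial l k)%:R = 0)%R.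
    move=> ltl; have /rowP/(_ (f (Ordinal ltl))) := uG; rewrite !mxE => {2}<-.
    by apply: eq_bigr => k _; rewrite /a inord_val GE.
  (* The unit vectors, [l = 0, 1, 3], isolate the coefficients of the squares; the points with two
     ones, [l = 2, 4, 5], then give the mixed ones. *)
  have a0 : a 0 = 0%R by move: (aG 0 isT); eval_monomials.
  have a3 : a 3 = 0%R by move: (aG 1 isT); eval_monomials.
  have a5 : a 5 = 0%R by move: (aG 3 isT); eval_monomials.
  have a1 : a 1 = 0%R.
    by move: (aG 2 isT); eval_monomials; rewrite a0 a3 add0r addr0.
  have a2 : a 2 = 0%R.
    by move: (aG 4 isT); eval_monomials; rewrite a0 a5 add0r addr0.
  have a4 : a 4 = 0%R.
    by move: (aG 5 isT); eval_monomials; rewrite a3 a5 add0r addr0.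
  apply/eqP/rowP=> k; rewrite mxE -[k]inord_val.
  by case: k => [[|[|[|[|[|[|//]]]]]] ltk].
have <- : \dim (g @: fullv) = 6.
  by rewrite limg_dim_eq ?ker_g ?capv0 // dimvf.
apply: dimvS; apply/subvP=> _ /memv_imgP[u _ ->].
rewrite lfunE /= mulmx_sum_row.
by apply: rpred_sum => k _; rewrite rpredZ // memv_span //; apply: image_f.
Qed.


End Fano.

(** * Solving the triangular system *)

Lemma qbinom_eq0 q d r : d < r -> qbinom q d r = 0.
Proof.
elim: d r => [|d IHd] [|r] //=; rewrite ltnS => lt_dr.
by rewrite !IHd ?muln0 // ltnW.
Qed.

Local Open Scope ring_scope.

(** For fixed [r], the equations for [s = 0, ..., 7] have numeral coefficients with unit diagonal,
    so linear arithmetic finds each unknown. *)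
Local Ltac solve_row H r w :=
  move: (H r 0%N isT) (H r 1%N isT) (H r 2%N isT) (H r 3%N isT)
        (H r 4%N isT) (H r 5%N isT) (H r 6%N isT) (H r 7%N isT);
  rewrite !big_ord_recr !big_ord0 /=;
  repeat match goal with
  | |- context [qbinom ?q ?d r] =>
    let v := eval vm_compute in (qbinom q d r) in change (qbinom q d r) with v
  | |- context [binomial ?a ?b] =>
    let v := eval vm_compute in (binomial a b) in change (binomial a b) with v
  end;
  case: w => [|[|[|[|[|[|[|[|//]]]]]]]] _ /=; lia.

Theorem theorem4p2 (P : 'I_(2 ^ 2 + 2 + 1) -> 'rV['F_2]_3)
    (hP : plane_representatives P) :
  let A := higher_weight (veronese_code P) in
  (A 1 2 = 21 /\ A 1 4 = 35 /\ A 1 6 = 7 /\ A 2 3 = 35 /\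
   A 2 4 = 105 /\ A 3 4 = 35 /\ A 2 5 = 210 /\ A 3 5 = 210 /\
   A 4 5 = 21 /\ A 2 6 = 210 /\ A 3 6 = 560 /\ A 4 6 = 175 /\
   A 5 6 = 7 /\ A 2 7 = 91 /\ A 3 7 = 590 /\ A 4 7 = 455 /\
   A 5 7 = 56 /\ A 6 7 = 1)%N /\
  (forall r w : nat, (0 < r)%N ->
     (r, w) \notin [:: (1, 2); (1, 4); (1, 6); (2, 3);
                       (2, 4); (3, 4); (2, 5); (3, 5);
                       (4, 5); (2, 6); (3, 6); (4, 6);
                       (5, 6); (2, 7); (3, 7); (4, 7);
                       (5, 7); (6, 7)]%N ->
     A r w = 0%N).
Proof.
have weight_sum r s : (s <= 7)%N ->
    (\sum_(w < 8) higher_weight (veronese_code P) r w * 'C(7 - w, 7 - s)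
       = 'C(7, s) * qbinom 2 (s - 1) r)%N.
  move=> le_s7; rewrite veronese_code_F2 //.
  have := higher_weight_sum _ _ _ (subn^~ 1%N) r _
            (dim_zero_sum_code 'F_2 7) le_s7.
  by rewrite card_Fp.
have weight_gt r w : (7 < w)%N -> higher_weight (veronese_code P) r w = 0%N.
  exact: higher_weight_gt.
set A := higher_weight _ in weight_sum weight_gt *.
clearbody A => A'; rewrite {}/A'.
have A_large r w : (6 < r)%N -> A r w = 0%N.
  move=> r_gt6; have [le_w7 | ] := leqP w 7; last exact: weight_gt.
  (* At [s = 7] every coefficient is 1 and the right side is 0, so each term of the sum vanishes. *)
  have := weight_sum r 7 isT; rewrite qbinom_eq0 // muln0 => /eqP.
  rewrite sum_nat_eq0 => /forallP/(_ (Ordinal (le_w7 : w < 8)%N)) /=.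
  by rewrite subnn bin0 muln1 => /eqP.
(* Row [r], column [w] holds the claimed value; the empty row stands for the excluded [r = 0]. *)
pose T := [:: [::];
               [:: 0; 0; 21; 0; 35; 0; 7; 0];
               [:: 0; 0; 0; 35; 105; 210; 210; 91];
               [:: 0; 0; 0; 0; 35; 210; 560; 590];
               [:: 0; 0; 0; 0; 0; 21; 175; 455];
               [:: 0; 0; 0; 0; 0; 0; 7; 56];
               [:: 0; 0; 0; 0; 0; 0; 0; 1]]%N.
have A_small r w : (0 < r <= 6)%N -> (w <= 7)%N ->
    A r w = nth 0%N (nth [::] T r) w.
  case: r => [//|[|[|[|[|[|[|//]]]]]]] _.
  - by solve_row weight_sum 1%N w.
  - by solve_row weight_sum 2%N w.
  - by solve_row weight_sum 3%N w.
  - by solve_row weight_sum 4%N w.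
  - by solve_row weight_sum 5%N w.
  - by solve_row weight_sum 6%N w.
split; first by rewrite !A_small.
move=> r w r_gt0 notin_rw; have [r_le6 | ] := leqP r 6; last exact: A_large.
have [w_le7 | ] := leqP w 7; last exact: weight_gt.
rewrite A_small ?r_gt0 //.
case: r r_gt0 notin_rw r_le6 => [//|[|[|[|[|[|[|//]]]]]]] _ + _.
all: by case: w w_le7 => [|[|[|[|[|[|[|[|//]]]]]]]].
Qed.
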